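(* Let $n_o,n_r,n_c,n_d$ be positive integers, put $n=n_o+n_r$ and $m=n_cn_d$, and let $h>0$. Let $\boldsymbol{Q}\in\mathbb{R}^{n\times n}$ be symmetric positive definite, $\tilde{\boldsymbol{J}}\in\mathbb{R}^{m\times n}$, $\boldsymbol{b}\in\mathbb{R}^{n}$, $\tilde{\boldsymbol{\phi}}\in\mathbb{R}^{m}$. Let $\boldsymbol{K}\in\mathbb{R}^{m\times m}$ be a positive definite diagonal matrix, and consider the complementarity problem for $\boldsymbol{\beta}\in\mathbb{R}^m$ $$\boldsymbol{0}\leq\boldsymbol{\beta}\;\perp\;\frac1h\boldsymbol{K}^{-1}\boldsymbol{\beta}+\left(\tilde{\boldsymbol{J}}\boldsymbol{Q}^{-1}\boldsymbol{b}+\tilde{\boldsymbol{\phi}}\right)\geq\boldsymbol{0}.$$ Then this problem has the closed-form solution $$\boldsymbol{\beta}^+=\max\left(-h\boldsymbol{K}\left(\tilde{\boldsymbol{J}}\boldsymbol{Q}^{-1}\boldsymbol{b}+\tilde{\boldsymbol{\phi}}\right),\boldsymbol{0}\right).$$ Furthermore, the corresponding approximate primal solution, i.e. the vector $\boldsymbol{v}^+:=\frac{1}{h^2}\boldsymbol{Q}^{-1}\left(h\boldsymbol{b}+\tilde{\boldsymbol{J}}^{\mathsf T}\boldsymbol{\beta}^+\right)$, is $$\boldsymbol{v}^+=\frac1h\boldsymbol{Q}^{-1}\boldsymbol{b}+\frac1h\boldsymbol{Q}^{-1}\tilde{\boldsymbol{J}}^{\mathsf T}\max\left(-\boldsymb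ol{K}\left(\tilde{\boldsymbol{J}}\boldsymbol{Q}^{-1}\boldsymbol{b}+\tilde{\boldsymbol{\phi}}\right),\boldsymbol{0}\right).$$
   Context: Vector inequalities and $\max(\cdot,\boldsymbol 0)$ are componentwise. For $x,y\in\mathbb{R}^m$, the notation $\boldsymbol 0\le x\perp y\ge \boldsymbol 0$ means $x\ge \boldsymbol 0$, $y\ge \boldsymbol 0$ and $x^{\mathsf T}y=0$. Origin of the data: the primal problem is the quadratic program $\min_{\boldsymbol v}\frac12h^2\boldsymbol v^{\mathsf T}\boldsymbol Q\boldsymbol v-h\boldsymbol v^{\mathsf T}\boldsymbol b$ subject to $\tilde{\boldsymbol J}\boldsymbol v+\tilde{\boldsymbol\phi}/h\ge\boldsymbol 0$ (a time-stepping contact model). Its optimal primal solution $\boldsymbol v^+$ and a dual solution $\boldsymbol\beta^+$ are related by $\boldsymbol{v}^+=\frac{1}{h^2}\boldsymbol{Q}^{-1}(h\boldsymbol{b}+\tilde{\boldsymbol{J}}^{\mathsf T}\boldsymbol{\beta}^+)$. The optimality condition of the dual regularized by a positive diagonal matrix $\boldsymbol R$ is $\boldsymbol{0}\leq\boldsymbol{\beta}\perp\frac1h(\tilde{\boldsymbol{J}}\boldsymbol{Q}^{-1}\tilde{\boldsymbol{J}}^{\mathsf T}+\boldsymbol{R})\boldsymbol{\beta}+(\tilde{\boldsymbol{J}}\boldsymbol{Q}^{-1}\boldsymbol{b}+\tilde{\boldsymbol{\phi}})\geq\boldsymbol{0}$. The complementarity problem in the claim is obtained from it by letting $\boldsymbol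 K$ replace $(\tilde{\boldsymbol{J}}\boldsymbol{Q}^{-1}\tilde{\boldsymbol{J}}^{\mathsf T}+\boldsymbol{R})^{-1}$. The ''approximate primal solution'' is the vector obtained by inserting the solution $\boldsymbol\beta^+$ of this replaced problem into the primal–dual relation. ($\boldsymbol K$ may depend on the system configuration $\boldsymbol q$, which is fixed here.) *)

(* Defs.v *)
From HB Require Import structures.
From mathcomp Require Import all_boot all_order all_algebra.
From mathcomp Require Import reals.

Set Implicit Arguments.
Unset Strict Implicit.
Unset Printing Implicit Defensive.

Import Order.TTheory GRing.Theory Num.Theory.
Local Open Scope ring_scope.

Definition le_vec (R : realType) (m : nat) (x y : 'cV[R]_m) : Prop :=
  forall i : 'I_m, x i 0 <= y i 0.

(* 0 <= x _|_ y >= 0; the product x^T y is a 1 x 1 matrix *)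
Definition complementary (R : realType) (m : nat) (x y : 'cV[R]_m) : Prop :=
  [/\ le_vec 0 x, le_vec 0 y & x^T *m y = 0].

(* Symmetry is not part of this notion. *)
Definition posdefmx (R : realType) (n : nat) (A : 'M[R]_n) : Prop :=
  forall x : 'cV[R]_n, x != 0 -> 0 < (x^T *m A *m x) 0 0.

(* The primal-dual relation v = h^-2 Q^-1 (h b + J^T beta) that recovers the
   velocity from a dual vector of the time-stepping quadratic program
   min_v h^2/2 v^T Q v - h v^T b  subject to  J v + phi / h >= 0. *)
Definition primal_of_dual (R : realType) (n m : nat) (h : R) (Q : 'M[R]_n)
    (J : 'M[R]_(m, n)) (b : 'cV[R]_n) (beta : 'cV[R]_m) : 'cV[R]_n :=
  (1 / h ^+ 2) *: (invmx Q *m (h *: b + J^T *m beta)).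

(* Optimality condition of the dual of that quadratic program, with K^-1 in
   place of J Q^-1 J^T + D, where D is the diagonal regularization. *)
Definition replaced_dual_lcp (R : realType) (n m : nat) (h : R) (Q : 'M[R]_n)
    (J : 'M[R]_(m, n)) (b : 'cV[R]_n) (phi : 'cV[R]_m) (K : 'M[R]_m)
    (beta : 'cV[R]_m) : Prop :=
  complementary beta
    ((1 / h) *: (invmx K *m beta) + (J *m invmx Q *m b + phi)).

(* Main.v *)
Require Import Defs.
From HB Require Import structures.
From mathcomp Require Import all_boot all_order all_algebra.
From mathcomp Require Import reals.

Set Implicit Arguments.
Unset Strict Implicit.
Unset Printing Implicit Defensive.

Import Order.TTheory GRing.Theory Num.Theory.
Local Open Scope ring_scope.

(** The matrix [K] being diagonal, the problem decouples into [m] scalar problems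
    [0 <= x _|_ x / a + c >= 0] with [a = h * K i i > 0], each of which forces
    [x = 0] or [x = - a * c], according to the sign of [c]. *)

Lemma scalar_lcp (R : realFieldType) (a c x : R) : 0 < a ->
  [/\ 0 <= x, 0 <= x / a + c & x * (x / a + c) = 0]
    <-> x = Num.max (- (a * c)) 0.
Proof.
move=> a_gt0; have a_neq0 : a != 0 by rewrite gt_eqF.
(* Over the common denominator [a > 0], the second factor has the sign of [x + a * c], and the
   product vanishes exactly when [x = 0] or [x = - (a * c)]. *)
have -> : x / a + c = (x + a * c) / a by rewrite mulrDl mulrAC divff ?mul1r.
rewrite pmulr_lge0 ?invr_gt0 // mulrA; split.
  case=> x_ge0 y_ge0 /eqP.
  rewrite mulf_eq0 invr_eq0 (negPf a_neq0) orbF mulf_eq0 => /orP[] /eqP xy0.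
    by move: y_ge0; rewrite xy0 add0r => ac_ge0; rewrite max_r ?oppr_le0.
  by move/eqP: xy0; rewrite addr_eq0 => /eqP xE; rewrite -xE max_l.
(* The case analysis also evaluates the maximum, so [x] becomes [0] in the first branch and
   [- (a * c)] in the second. *)
case: (leP (- (a * c)) 0) => [ac_ge0 ->|ac_lt0 ->].
  by rewrite add0r !mul0r -oppr_le0.
by rewrite addNr mulr0 mul0r ltW.
Qed.

(** The inner product is a sum of nonnegative terms, so it vanishes only if every term does. This is
    what decouples the coordinates. *)
Lemma complementaryP (R : realType) (m : nat) (x y : 'cV[R]_m) :
  complementary x y
    <-> forall i, [/\ 0 <= x i 0, 0 <= y i 0 & x i 0 * y i 0 = 0].
Proof.
have dotE : (x^T *m y) 0 0 = \sum_i x i 0 * y i 0.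
  by rewrite mxE; apply: eq_bigr => i _; rewrite mxE.
split=> [[x_ge0 y_ge0 xy0] i|xy].
  have {}x_ge0 j : 0 <= x j 0 by have := x_ge0 j; rewrite mxE.
  have {}y_ge0 j : 0 <= y j 0 by have := y_ge0 j; rewrite mxE.
  split=> //; move/eqP: dotE; rewrite xy0 mxE eq_sym psumr_eq0.
    by move/allP/(_ i (mem_index_enum i))/eqP.
  by move=> j _; apply: mulr_ge0.
split=> [i|i|]; rewrite ?mxE; try by case: (xy i).
apply/matrixP=> i j; rewrite !ord1 dotE mxE big1 // => k _.
by case: (xy k).
Qed.

(** The quadratic form at the [i]-th basis vector is [A i i]. *)
Lemma posdefmx_diag_gt0 (R : realType) (n : nat) (A : 'M[R]_n) (i : 'I_n) :
  posdefmx A -> 0 < A i i.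
Proof.
move=> /(_ (delta_mx i 0)); rewrite trmx_delta -rowE -colE !mxE; apply.
by apply/eqP=> /matrixP/(_ i 0); rewrite !mxE !eqxx => /eqP; rewrite oner_eq0.
Qed.

Lemma invmx_diag (F : fieldType) (n : nat) (d : 'rV[F]_n) :
  (forall i, d 0 i != 0) -> invmx (diag_mx d) = diag_mx (map_mx GRing.inv d).
Proof.
move=> d_neq0; have dV : diag_mx d *m diag_mx (map_mx GRing.inv d) = 1%:M.
  rewrite mulmx_diag -diag_const_mx; congr diag_mx.
  by apply/rowP=> i; rewrite !mxE divff.
(* For square matrices a one-sided inverse already gives invertibility. *)
have [d_unit _] := mulmx1_unit dV.
by rewrite -[RHS](mulKmx d_unit) dV mulmx1.
Qed.

(** Scaling by [h >= 0] preserves order and fixes [0]. This lets the factor [h] leave the maximum in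
    the primal formula. *)
Lemma map2_max_scale (R : realFieldType) (m n : nat) (h : R) (A : 'M[R]_(m, n)) :
  0 <= h -> map2_mx Num.max (h *: A) 0 = h *: map2_mx Num.max A 0.
Proof.
by move=> h_ge0; apply/matrixP=> i j; rewrite !mxE maxr_pMr // mulr0.
Qed.

Theorem lemma2 (R : realType) (no nr nc nd : nat)
    (no_gt0 : (0 < no)%N) (nr_gt0 : (0 < nr)%N)
    (nc_gt0 : (0 < nc)%N) (nd_gt0 : (0 < nd)%N)
    (h : R) (h_gt0 : 0 < h)
    (Q : 'M[R]_(no + nr)) (Q_sym : Q^T = Q) (Q_pd : posdefmx Q)
    (J : 'M[R]_(nc * nd, no + nr)) (b : 'cV[R]_(no + nr))
    (phi : 'cV[R]_(nc * nd))
    (K : 'M[R]_(nc * nd)) (K_diag : is_diag_mx K) (K_pd : posdefmx K) :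
  let betap : 'cV[R]_(nc * nd) :=
    map2_mx Num.max (- (h *: (K *m (J *m invmx Q *m b + phi)))) 0 in
  (forall beta : 'cV[R]_(nc * nd),
     replaced_dual_lcp h Q J b phi K beta <-> beta = betap) /\
  primal_of_dual h Q J b betap =
    (1 / h) *: (invmx Q *m b) +
    (1 / h) *: (invmx Q *m J^T *m
                  map2_mx Num.max (- (K *m (J *m invmx Q *m b + phi))) 0).
Proof.
set c := J *m invmx Q *m b + phi => betap; split=> [beta|].
  have [d KE] := diag_mxP _ K_diag.
  have d_gt0 i : 0 < d 0 i.
    by have := posdefmx_diag_gt0 i K_pd; rewrite KE !mxE eqxx.
  rewrite /replaced_dual_lcp -/c KE invmx_diag => [|i]; last by rewrite gt_eqF.
  (* Each entry takes the shape [x / a + c] of [scalar_lcp], with [a = h * d 0 i]. *)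
  have lcpE x i : ((1 / h) *: (diag_mx (map_mx GRing.inv d) *m x) + c) i 0
      = x i 0 / (h * d 0 i) + c i 0.
    by rewrite mul_diag_mx !mxE div1r invfM mulrA mulrC.
  have betapE i : betap i 0 = Num.max (- (h * d 0 i * c i 0)) 0.
    by rewrite /betap KE mul_diag_mx !mxE mulrA.
  have hd_gt0 i : 0 < h * d 0 i by rewrite mulr_gt0.
  (* The first direction gives uniqueness of the solution, the second that [betap] solves the
     problem. *)
  rewrite complementaryP; split=> [lcp|-> i].
    apply/colP=> i; rewrite betapE; apply/(scalar_lcp _ _ (hd_gt0 i)).
    by have := lcp i; rewrite lcpE.
  by rewrite lcpE; apply/(scalar_lcp _ _ (hd_gt0 i)).
(* Both summands, [h *: b] and [J^T *m betap], now carry a factor [h], which reduces [1 / h ^+ 2] to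
   [1 / h]. *)
rewrite /primal_of_dual /betap -scalerN map2_max_scale ?ltW //.
rewrite -scalemxAr -!scalerDr -scalemxAr scalerA mulmxDr mulmxA.
by rewrite expr2 !div1r invfM mulfVK ?gt_eqF.
Qed.
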